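(* Let $V$ be a real Banach space and let $M\subseteq V^*$ be a weak-star compact subset. If $M$ is tame as a bounded subset of the Banach space $V^*$ (i.e., tame as a family of functions over $B_{V^{**}}$), then $M$ is co-tame, i.e. every bounded subset $A\subseteq V$ is tame as a family of functions over $M$.
   Context: $B_W$ denotes the closed unit ball of a Banach space $W$. A sequence of functions $f_n:X\to\mathbb{R}$ on a set $X$ is independent if there are reals $a<b$ such that $\bigcap_{n\in P}f_n^{-1}((-\infty,a])\cap\bigcap_{n\in Q}f_n^{-1}([b,\infty))\ne\emptyset$ for all finite disjoint $P,Q\subseteq\mathbb{N}$. A bounded family of (not necessarily continuous) real functions on $X$ is tame over $X$ if it contains no independent sequence. Elements of $V^*$ are regarded as functions on $B_{V^{**}}$ by $\xi\mapsto\langle \xi,\varphi\rangle$ for $\xi\in B_{V^{**}}$, $\varphi\in V^*$; elements of $V$ are regarded as functions on $M\subseteq V^*$ by evaluation, $\varphi\mapsto\varphi(x)$. *)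

(* Defs.v *)
From HB Require Import structures.
From mathcomp Require Import all_boot all_order all_algebra.
From mathcomp Require Import all_classical all_reals all_analysis.
Set Implicit Arguments.
Unset Strict Implicit.
Unset Printing Implicit Defensive.
Import Order.TTheory GRing.Theory Num.Theory.
Import numFieldNormedType.Exports.
Local Open Scope classical_set_scope.
Local Open Scope ring_scope.

Section Dual.
Context {R : realType}.
Implicit Type V : normedModType R.

Definition continuous_linear_form (V : normedModType R) : {pred V -> R^o} :=
  [pred f | `[< linear f /\ continuous f >]].

Arguments continuous_linear_form : clear implicits.

Record dual_space V := Dual {
  dual_fun :> V -> R^o;
  _ : dual_fun \in continuous_linear_form V }.

HB.instance Definition _ V := [isSub for @dual_fun V].
HB.instance Definition _ V := [Choice of dual_space V by <:].

Lemma continuous_linear_form_submod V :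
  submod_closed (continuous_linear_form V).
Proof.
split.
  apply/asboolP; split; last exact: cst_continuous.
  by move=> a x y; rewrite scaler0 addr0.
move=> a f g /asboolP[lf cf] /asboolP[lg cg]; apply/asboolP; split.
  move=> b x y.
  rewrite [LHS]/(a *: f (b *: x + y) + g (b *: x + y)) lf lg.
  suff E (p q r s : R) :
      a * (b * p + q) + (b * r + s) = b * (a * p + r) + (a * q + s).
    exact: E.
  by rewrite !mulrDr !mulrA (mulrC b a) addrACA.
move=> x; apply: cvgD; last exact: cg.
by apply: cvgZr; exact: cf.
Qed.

HB.instance Definition _ V := GRing.isSubmodClosed.Build _ _
  (continuous_linear_form V) (continuous_linear_form_submod V).
HB.instance Definition _ V := [SubChoice_isSubLmodule of dual_space V by <:].

(* `closed_ball` is the closure of the open ball; the norm inequality is used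
   instead, so that the same set serves in the definition of the dual norm. *)
Definition unit_ball (V : normedModType R) : set V := [set x | `|x| <= 1].
Arguments unit_ball : clear implicits.

Definition dual_norm V (f : dual_space V) : R :=
  sup [set `|f x| | x in unit_ball V].

Lemma dual_linear V (f : dual_space V) : linear f.
Proof. by case: f => f /= /asboolP[]. Qed.

Lemma dual_continuous V (f : dual_space V) : continuous f.
Proof. by case: f => f /= /asboolP[]. Qed.

HB.instance Definition _ V (f : dual_space V) :=
  GRing.isLinear.Build R V R^o *:%R f (dual_linear f).

Lemma dual_has_sup V (f : dual_space V) :
  has_sup [set `|f x| | x in unit_ball V].
Proof.
split; first by exists `|f 0|, 0 => //=; rewrite /unit_ball /= normr0.
have /linear_boundedP : bounded_near f (nbhs (0 : V)).
  exact/linear_bounded_continuous/dual_continuous.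
move=> /pinfty_ex_gt0[M M0 fM]; exists M => _ [x x1 <-].
by rewrite (le_trans (fM x))// ger_pMr.
Qed.

Lemma dual_norm_ge0 V (f : dual_space V) : 0 <= dual_norm f.
Proof.
have := @sup_ubound _ _ (proj2 (dual_has_sup f)) `|f 0|.
rewrite (linear0 f) normr0; apply.
by exists 0; rewrite ?linear0 ?normr0 // /unit_ball /= normr0.
Qed.

Lemma dual_norm_le V (f : dual_space V) (x : V) : `|f x| <= dual_norm f * `|x|.
Proof.
have [->|x0] := eqVneq x 0; first by rewrite linear0 !normr0 mulr0.
have nx0 : 0 < `|x| by rewrite normr_gt0.
rewrite -ler_pdivrMr//.
apply: (@sup_ubound _ _ (proj2 (dual_has_sup f))).
exists (`|x|^-1 *: x).
  by rewrite /unit_ball /= normrZ normfV normr_id mulVf ?gt_eqF.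
by rewrite linearZ normrZ normfV normr_id mulrC.
Qed.

Lemma dual_normD V (f g : dual_space V) :
  dual_norm (f + g) <= dual_norm f + dual_norm g.
Proof.
apply: ge_sup; first exact: (proj1 (dual_has_sup _)).
move=> _ [x x1 <-]; rewrite [X in `|X|]/(f x + g x).
rewrite (le_trans (ler_normD _ _))// lerD// (le_trans (dual_norm_le _ _))//.
  by rewrite ler_piMr// dual_norm_ge0.
by rewrite ler_piMr// dual_norm_ge0.
Qed.

Lemma dual_normZ_le V (a : R) (f : dual_space V) :
  dual_norm (a *: f) <= `|a| * dual_norm f.
Proof.
apply: ge_sup; first exact: (proj1 (dual_has_sup _)).
move=> _ [x x1 <-]; rewrite [X in `|X|]/(a * f x) normrM ler_wpM2l//.
by rewrite (le_trans (dual_norm_le _ _))// ler_piMr// dual_norm_ge0.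
Qed.

Lemma dual_normZ V (a : R) (f : dual_space V) :
  dual_norm (a *: f) = `|a| * dual_norm f.
Proof.
apply/eqP; rewrite eq_le dual_normZ_le/=.
have [->|a0] := eqVneq a 0; first by rewrite normr0 mul0r dual_norm_ge0.
rewrite mulrC -ler_pdivlMr ?normr_gt0// mulrC -normfV.
rewrite -[X in dual_norm X <= _](scalerK a0).
exact: dual_normZ_le.
Qed.

Lemma dual_norm0_eq0 V (f : dual_space V) : dual_norm f = 0 -> f = 0.
Proof.
move=> f0; apply/val_inj/funext => x; apply/eqP; rewrite -normr_le0.
by rewrite (le_trans (dual_norm_le f x))// f0 mul0r.
Qed.

HB.instance Definition _ V := @Lmodule_isNormed.Build R (dual_space V)
  (@dual_norm V) (@dual_normD V) (@dual_normZ V) (@dual_norm0_eq0 V).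

(* The topology of pointwise convergence on V. *)
Definition weak_star V : Type :=
  initial_topology (@dual_fun V : dual_space V -> {ptws V -> R^o}).

HB.instance Definition _ V := Topological.copy (weak_star V)
  (initial_topology (@dual_fun V : dual_space V -> {ptws V -> R^o})).

Definition weak_star_compact V (M : set (dual_space V)) : Prop :=
  compact (M : set (weak_star V)).

Definition dual_eval V (x : V) : dual_space V -> R := fun phi => phi x.

(* A family of functions on a subset X of T is given by functions on T, of
   which only the values on X matter. *)
Definition independent (T : Type) (X : set T) (f : nat -> T -> R) : Prop :=
  exists a b : R, a < b /\
    forall P Q : set nat, finite_set P -> finite_set Q -> [disjoint P & Q] ->
      X `&` (\bigcap_(n in P) f n @^-1` `]-oo, a])
        `&` (\bigcap_(n in Q) f n @^-1` `[b, +oo[) !=set0.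

Definition bounded_family (T : Type) (X : set T) (F : set (T -> R)) : Prop :=
  exists K : R, forall f, F f -> forall x, X x -> `|f x| <= K.

Definition tame (T : Type) (X : set T) (F : set (T -> R)) : Prop :=
  bounded_family X F /\
  ~ exists f : nat -> T -> R, (forall n, F (f n)) /\ independent X f.

Definition tame_subset (W : normedModType R) (A : set W) : Prop :=
  tame (unit_ball (dual_space W)) (@dual_eval W @` A).

Definition co_tame V (M : set (dual_space V)) : Prop :=
  forall A : set V, bounded_set A -> tame M (@dual_eval V @` A).

End Dual.

Arguments unit_ball {R} V.
Arguments continuous_linear_form {R} V.

(* Main.v *)
From HB Require Import structures.
From mathcomp Require Import all_boot all_order all_algebra.
From mathcomp Require Import all_classical all_reals all_analysis.
Require Import Defs.

(** Independence is self-dual. If [x_n] is independent over [M] with bounds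
    [a < b] then, [M] being weak-star compact, every set [S] of indices,
    possibly infinite, is realized by some [phi_S] in [M]: [phi_S x_n <= a] for
    [n] in [S] and [phi_S x_n >= b] for [n] outside. Let [n] range over codes of
    finite sets of naturals and take [S_k], the codes of the sets containing
    [k]. If [n] codes [P] then [x_n], seen in the bidual, separates the
    [phi_(S_k)], [k] in [P], from all the others; so, after rescaling [x_n] into
    the unit ball, the [phi_(S_k)] form an independent sequence in [M]. *)

Set Implicit Arguments.
Unset Strict Implicit.
Unset Printing Implicit Defensive.
Import Order.TTheory GRing.Theory Num.Theory.
Import numFieldNormedType.Exports.
Local Open Scope classical_set_scope.
Local Open Scope ring_scope.

Section CanonicalEmbedding.
Context {R : realType} {V : normedModType R}.

Lemma dual_eval_linear (x : V) : linear (dual_eval x : dual_space V -> R^o).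
Proof. by []. Qed.

Lemma dual_eval_continuous (x : V) :
  continuous (dual_eval x : dual_space V -> R^o).
Proof.
pose ev : {linear dual_space V -> R^o} := HB.pack (dual_eval x : _ -> R^o)
  (GRing.isLinear.Build R (dual_space V) R^o *:%R _ (dual_eval_linear x)).
suff: continuous ev by [].
apply/linear_bounded_continuous/linear_boundedP.
(* Any [r >= |x|] is a bound, because [|phi x| <= dual_norm phi * |x|]. *)
near=> r => phi.
rewrite (le_trans (dual_norm_le phi x))// mulrC ler_wpM2r ?dual_norm_ge0//.
Unshelve. all: by end_near. Qed.

Lemma dual_eval_subproof (x : V) :
  (dual_eval x : dual_space V -> R^o) \in continuous_linear_form (dual_space V).
Proof.
apply/asboolP; split; [exact: dual_eval_linear|exact: dual_eval_continuous].
Qed.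

Definition bidual_embed (x : V) : dual_space (dual_space V) :=
  Dual (dual_eval_subproof x).

Lemma bidual_embed_unit_ball (x : V) :
  `|x| <= 1 -> unit_ball (dual_space (dual_space V)) (bidual_embed x).
Proof.
move=> x1; apply: ge_sup; first exact: (proj1 (dual_has_sup _)).
move=> _ [phi phi1 <-]; rewrite (le_trans (dual_norm_le phi x))//.
by rewrite mulr_ile1 ?dual_norm_ge0.
Qed.

Lemma weak_star_eval_continuous (x : V) :
  continuous (dual_eval x : weak_star V -> R).
Proof.
move=> phi.
have c1 : continuous (@dual_fun R V : weak_star V -> {ptws V -> R^o}).
  exact: initial_continuous.
have c2 := @proj_continuous V (fun=> R^o) x.
exact: (continuous_comp (c1 phi) (c2 _)).
Qed.

(** Passes from finitely many closed conditions to all of them: solutions [phi N] of the first [N]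
    conditions cluster in [M], and weak-star continuity of evaluation carries each condition over to
    the cluster point. *)
Lemma weak_star_compact_realize (M : set (dual_space V)) (x : nat -> V)
    (C : nat -> set R) :
  weak_star_compact M -> (forall n, closed (C n)) ->
  (forall N, exists2 phi, M phi & forall n, (n < N)%N -> C n (phi (x n))) ->
  exists2 phi, M phi & forall n, C n (phi (x n)).
Proof.
move=> cM cC finC.
have /choice[phi phiP] N : exists f : dual_space V,
    M f /\ forall n, (n < N)%N -> C n (f (x n)).
  by have [f Mf fC] := finC N; exists f.
have [|psi [Mpsi clpsi]] := cM ((phi : nat -> weak_star V) @ \oo) _.
  by exists 0%N => // N _; case: (phiP N).
exists psi => // n.
have /closure_id -> := cC n.
move=> B Bx; have Bpsi := @weak_star_eval_continuous (x n) psi B Bx.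
have [|f [Cf Bf]] := clpsi (dual_eval (x n) @^-1` C n) _ _ Bpsi.
  (* Condition [n] holds for [phi N] as soon as [n < N], hence along a tail of the sequence. *)
  by exists n.+1 => // N /= nN; apply: (phiP N).2.
by exists (dual_eval (x n) f).
Qed.

End CanonicalEmbedding.

Lemma independent_dual (R : realType) (V : normedModType R)
    (M : set (dual_space V)) (x : nat -> V) (K : R) :
  weak_star_compact M -> 0 < K -> (forall n, `|x n| <= K) ->
  independent M (fun n => dual_eval (x n)) ->
  exists phi : nat -> dual_space V, (forall k, M (phi k)) /\
    independent (unit_ball (dual_space (dual_space V)))
      (fun k => dual_eval (phi k)).
Proof.
move=> cM K0 xK [a [b [ab indx]]].
have real (S : set nat) : exists phi : dual_space V, M phi /\
    forall n, (S n -> phi (x n) <= a) /\ (~ S n -> b <= phi (x n)).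
  have [||phi Mphi phiP] := @weak_star_compact_realize R V M x
    (fun n => if `[< S n >] then `]-oo, a]%classic else `[b, +oo[%classic) cM.
  - by move=> n; case: ifP => _; [exact: lray_closed|exact: rray_closed].
  - move=> N.
    (* Independence handles only finite sets, so [S] and its complement are cut off at [N]. *)
    have [|||phi [[Mphi phiP] phiQ]] := indx (`I_N `&` S) (`I_N `&` ~` S).
    + exact/finite_setIl/finite_II.
    + exact/finite_setIl/finite_II.
    + by apply/disj_setPS => n [[_ ?] [_ ?]].
    exists phi => // n nN; case: asboolP => Sn; first exact: phiP.
    exact: phiQ.
  exists phi; split=> // n; have := phiP n.
  case: asboolP => Sn; rewrite /= in_itv /=; first by move=> h; split.
  by rewrite andbT => h; split.
(* The default [[::]] for numbers that code no list is harmless: below, [S k] is only tested at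
   [n = pickle s]. *)
pose S k : set nat := [set n | k \in odflt [::] (unpickle n : option (seq nat))].
have [phi phiP] := choice (fun k => real (S k)).
exists phi; split=> [k|]; first by case: (phiP k).
exists (K^-1 * a), (K^-1 * b); split; first by rewrite ltr_pM2l// invr_gt0.
move=> P Q /finite_seqP[s ->] _ /disj_setPS sQ.
pose n := pickle s.
have SE k : S k n = (k \in s) by rewrite /S /mkset /n pickleK.
(* The value of [phi k] at this point is [K^-1 * phi k (x n)], so [k \in s] decides on which side it
   falls. *)
exists (bidual_embed (K^-1 *: x n)); split; [split|].
- apply: bidual_embed_unit_ball.
  by rewrite normrZ gtr0_norm ?invr_gt0// ler_pdivrMl// mulr1.
- move=> k /= ks; rewrite in_itv /= /dual_eval /= /dual_eval linearZ /=.
  rewrite ler_pM2l ?invr_gt0//.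
  by apply: ((phiP k).2 n).1; rewrite SE.
- move=> k /= Qk; rewrite in_itv /= /dual_eval /= /dual_eval linearZ /= andbT.
  rewrite ler_pM2l ?invr_gt0//.
  by apply: ((phiP k).2 n).2; rewrite SE => ks; apply: (sQ k).
Qed.

Theorem theorem4p3 (R : realType) (V : completeNormedModType R)
    (M : set (dual_space V)) :
  weak_star_compact M -> tame_subset M -> co_tame M.
Proof.
move=> cM [[C MC] tM] A /pinfty_ex_gt0[K K0 AK].
have AKx x : A x -> `|x| <= K by exact: AK.
split.
  (* [C] bounds [M] over the bidual ball; testing it at the image of [K^-1 *: x] gives
     [|phi x| <= K * C]. *)
  exists (K * C) => _ [x Ax <-] phi Mphi.
  have /(MC (dual_eval phi)) : unit_ball (dual_space (dual_space V))
      (bidual_embed (K^-1 *: x)).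
    apply: bidual_embed_unit_ball.
    by rewrite normrZ gtr0_norm ?invr_gt0// ler_pdivrMl// mulr1 AKx.
  rewrite /dual_eval /= /dual_eval linearZ /= normrM gtr0_norm ?invr_gt0//.
  by rewrite ler_pdivrMl//; apply; exists phi.
move=> [f [Af indf]].
have /choice[x xP] n : exists y, A y /\ dual_eval y = f n.
  by have [y Ay yf] := Af n; exists y.
have fE : f = (fun n => dual_eval (x n)) by apply/funext => n; case: (xP n).
have [||phi [Mphi indphi]] := @independent_dual R V M x K cM K0.
- by move=> n; apply: AKx; case: (xP n).
- by rewrite -fE.
by apply: tM; exists (fun k => dual_eval (phi k)); split=> // k; exists (phi k).
Qed.
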